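(* Let $(X,T)$ be a topological dynamical system, $\mu\in M(X,T)$ and $f\in L^2(\mu)$. Then $f$ is rigid if and only if there exists a subsequence $A=\{a_i:i\in\mathbb{N}\}$ of $\mathbb{N}$ such that $f$ is $\mu$-$A$-equicontinuous.
   Context: A topological dynamical system $(X,T)$ is a non-empty compact metric space $X$ with metric $d$ together with a homeomorphism $T:X\to X$. $M(X,T)$ is the set of $T$-invariant regular Borel probability measures on $X$. $\mathbb{N}$ denotes the non-negative integers. A subsequence $A=\{a_i:i\in\mathbb{N}\}$ of $\mathbb{N}$ is an infinite set of natural numbers listed in strictly increasing order. $f\in L^2(\mu)$ is rigid if there is a subsequence $\{t_k\}$ of $\mathbb{N}$ (possibly depending on $f$) such that $f\circ T^{t_k}\to f$ in $L^2(\mu)$. A subset $K\subset X$ is $f$-$A$-equicontinuous if for every $\epsilon>0$ there is $\delta>0$ such that for all $x,y\in K$ with $d(x,y)<\delta$ one has $|f(T^{a_n}x)-f(T^{a_n}y)|<\epsilon$ for all $n\in\mathbb{N}$. $f$ is $\mu$-$A$-equicontinuous if for every $\tau>0$ there is a compact $f$-$A$-equicontinuous set $K\subset X$ with $\mu(K)>1-\tau$. (Here $f$ is evaluated pointwise through a representative.) *)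

(* Defs.v *)
From HB Require Import structures.
From mathcomp Require Import all_boot all_order all_algebra.
From mathcomp Require Import all_classical all_reals all_analysis.
From mathcomp Require Import complex.

Set Implicit Arguments.
Unset Strict Implicit.
Unset Printing Implicit Defensive.

Import Order.TTheory GRing.Theory Num.Theory.
Import numFieldNormedType.Exports.

Local Open Scope classical_set_scope.
Local Open Scope ring_scope.

(* The library's [metricType] may be empty and [g_sigma_algebraType] asks for
   an inhabited carrier, so a non-empty metric space is a pointed one. *)
#[short(type="pmetricType")]
HB.structure Definition PointedMetric (K : numDomainType) :=
  { M of Metric K M & Pointed M }.

Notation borelType X := (g_sigma_algebraType (@open X)).

Definition homeomorphism (X Y : topologicalType) (h : X -> Y) : Prop :=
  continuous h /\
  exists g : Y -> X, [/\ cancel h g, cancel g h & continuous g].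

Definition regular_measure (R : realType) (X : pmetricType R)
    (mu : {measure set (borelType X) -> \bar R}) : Prop :=
  forall B : set (borelType X), measurable B ->
    mu B = ereal_sup [set mu K | K in [set K : set X | compact K /\ K `<=` B]]
    /\
    mu B = ereal_inf [set mu U | U in [set U : set X | open U /\ B `<=` U]].

Definition invariant_measure (R : realType) (X : pmetricType R) (T : X -> X)
    (mu : {measure set (borelType X) -> \bar R}) : Prop :=
  forall B : set (borelType X), measurable B -> mu (T @^-1` B) = mu B.

(* L^2(mu) over the complex numbers, through Borel representatives
   f : X -> R[i]; a complex function is Borel iff its two parts are. The norm
   of R[i] takes values in R[i], hence the real modulus [Normc.normc]. *)
Definition cLnorm2 (R : realType) (X : pmetricType R)
    (mu : {measure set (borelType X) -> \bar R}) (f : X -> R[i]) : \bar R :=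
  ('N[mu]_2%:E[EFin \o (fun x => Normc.normc (f x))])%E.

Definition in_L2 (R : realType) (X : pmetricType R)
    (mu : {measure set (borelType X) -> \bar R}) (f : X -> R[i]) : Prop :=
  [/\ measurable_fun [set: borelType X] (fun x => complex.Re (f x)),
      measurable_fun [set: borelType X] (fun x => complex.Im (f x))
    & (cLnorm2 mu f < +oo)%E].

(* An infinite subset {a_0 < a_1 < ...} of nat is given by its increasing
   enumeration. *)
Definition subsequence (a : nat -> nat) : Prop :=
  {homo a : i j / (i < j)%N}.

Definition rigid (R : realType) (X : pmetricType R) (T : X -> X)
    (mu : {measure set (borelType X) -> \bar R}) (f : X -> R[i]) : Prop :=
  exists2 t : nat -> nat, subsequence t &
    (fun k => cLnorm2 mu (fun x => f (iter (t k) T x) - f x))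
      @ \oo --> (0 : \bar R)%E.

Definition equicontinuous_on (R : realType) (X : pmetricType R) (T : X -> X)
    (f : X -> R[i]) (a : nat -> nat) (K : set X) : Prop :=
  forall eps : R, 0 < eps -> exists2 delta : R, 0 < delta &
    forall x y, K x -> K y -> mdist x y < delta ->
      forall n, Normc.normc (f (iter (a n) T x) - f (iter (a n) T y)) < eps.

Definition measure_equicontinuous (R : realType) (X : pmetricType R)
    (T : X -> X) (mu : {measure set (borelType X) -> \bar R})
    (f : X -> R[i]) (a : nat -> nat) : Prop :=
  forall tau : R, 0 < tau -> exists K : set X,
    [/\ compact K, equicontinuous_on T f a K & (mu K > (1 - tau)%:E)%E].

(* Main.v *)
Require Import Defs.
From mathcomp Require Import all_boot all_order all_algebra.
From mathcomp Require Import finmap.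
From mathcomp Require Import all_classical all_reals all_analysis.
From mathcomp Require Import measurable_realfun complex ring lra.

Set Implicit Arguments.
Unset Strict Implicit.
Unset Printing Implicit Defensive.

Import Order.TTheory GRing.Theory Num.Theory.
Import numFieldNormedType.Exports.

Local Open Scope classical_set_scope.
Local Open Scope ring_scope.

(** Rigidity of [f] says that [f] is a limit in L^2 of its own translates
    [f o T^t] along large [t]; by extracting a subsequence this is the same as
    recurrence: arbitrarily large [t] bring [f o T^t] arbitrarily close to [f]
    ([rigidP]). Both implications go through recurrence.

    From recurrence to equicontinuity. Choose times [a_n] along which
    [f o T^(a_n)] tends to [f] so fast that, by Chebyshev and Borel-Cantelli, the
    convergence is uniform off a set of small measure
    ([uniform_off_small_set]). Lusin's theorem, applied to [f] and to all the
    [f o T^(a_n)] at once ([lusin]), gives a large compact set on which each of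
    these functions is uniformly continuous. On a large compact set there is thus
    a uniformly convergent sequence of uniformly continuous functions, and such a
    sequence is equicontinuous ([recurrent_equicontinuous]).

    From equicontinuity to recurrence. The idea is the one of Arzela-Ascoli: the
    family [f o T^(a_n)] is totally bounded in L^2. Equicontinuity on a large
    compact set makes each member of the family nearly determined, on that set,
    by its values at a finite net; but the values may be unbounded, and the
    complement of the compact set must be controlled. Both problems disappear
    after truncation. Clamping a real function to [[-M, M]] is 1-Lipschitz, so it
    keeps equicontinuity, and by invariance the truncation error in L^2 is the same
    for all [n]. Rounding the clamped values at the net then colours the indices
    [n] with finitely many colours so that indices of the same colour give functions
    close in L^2 ([equicontinuous_colouring]). By the pigeonhole principle two
    indices with a large gap [t = a_q - a_p] share their colour, and invariance
    turns closeness of [f o T^(a_q)] and [f o T^(a_p)] into closeness of [f o T^t]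
    and [f] ([colouring_return]). *)

(** * Sequences and sets of reals *)

Lemma ge0_cvge0P (R : realType) (u : nat -> \bar R) :
  (forall k, 0 <= u k)%E ->
  u @ \oo --> 0%E <-> forall e : R, 0 < e -> \forall k \near \oo, (u k < e%:E)%E.
Proof.
move=> u0; split=> [/fine_cvgP[ufin ucvg] e e0|ult].
  apply: filterS2 _ ufin (cvgr0_norm_lt _ ucvg e e0) => k uk.
  by rewrite ger0_norm ?fine_ge0// -lte_fin fineK.
have ufin : \forall k \near \oo, u k \is a fin_num.
  apply: filterS (ult 1 ltr01) => k uk.
  by rewrite ge0_fin_numE// (lt_trans uk)// ltry.
apply/fine_cvgP; split=> //; apply/cvgr0Pnorm_lt => e e0.
apply: filterS2 _ ufin (ult e e0) => k uk /=.
by rewrite ger0_norm ?fine_ge0// -lte_fin fineK.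
Qed.

(** Greedy extraction: each new term is chosen beyond the previous one. *)
Lemma exists_subsequence (P : nat -> nat -> Prop) :
  (forall k N, exists2 t, (N < t)%N & P k t) ->
  exists2 s, subsequence s & forall k, P k (s k).
Proof.
move=> next; pose g k N := projT1 (cid2 (next k N)).
pose s := fix s k := if k is k'.+1 then g k (s k') else g 0%N 0%N.
exists s => [|[|k]]; [|by rewrite /= /g; case: cid2..].
apply: homo_ltn => [? ? ?|k]; first exact: ltn_trans.
have -> : s k.+1 = g k.+1 (s k) by [].
by rewrite /g; case: cid2.
Qed.

Lemma subsequence_ge s k : subsequence s -> (k <= s k)%N.
Proof.
move=> ss; elim: k => // k IH; exact: leq_ltn_trans IH (ss _ _ (ltnSn k)).
Qed.

Lemma min_modulus (R : realType) (P : nat -> R -> Prop) (N : nat) :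
  (forall n, exists2 d, 0 < d & P n d) ->
  (forall n d d', d' <= d -> P n d -> P n d') ->
  exists2 d, 0 < d & forall n, (n < N)%N -> P n d.
Proof.
move=> exP anti; elim: N => [|N [d d0 dP]]; first by exists 1.
have [d' d'0 d'P] := exP N.
exists (Num.min d d'); first by rewrite lt_min d0.
move=> n; rewrite ltnS leq_eqVlt => /orP[/eqP->|/dP].
  by apply: anti d'P; rewrite ge_min lexx orbT.
by apply: anti; rewrite ge_min lexx.
Qed.

Lemma floor_eq_dist (R : realType) (x y : R) :
  Num.floor x = Num.floor y -> `|x - y| < 1.
Proof.
move=> xy; have /andP[x1 x2] := floor_itv x.
have /andP[] := floor_itv y; rewrite -xy => y1 y2.
move: x2 y2; rewrite intrD ltr_norml => x2 y2; apply/andP; split; lra.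
Qed.

(** * The modulus of a complex number *)

Lemma normc_ge0 (R : rcfType) (z : R[i]) : 0 <= Normc.normc z.
Proof. by case: z => a b; exact: sqrtr_ge0. Qed.

Lemma normc_dist (R : rcfType) (x y : R[i]) :
  Normc.normc (x - y) = Normc.normc (y - x).
Proof. by rewrite -opprB normcN. Qed.

Lemma normc_dist_trans (R : rcfType) (y x z : R[i]) :
  Normc.normc (x - z) <= Normc.normc (x - y) + Normc.normc (y - z).
Proof. by rewrite -[x - z](subrKA y); exact: le_normcD. Qed.

Lemma sqr_normcE (R : rcfType) (z : R[i]) :
  Normc.normc z ^+ 2 = complex.Re z ^+ 2 + complex.Im z ^+ 2.
Proof. by case: z => a b /=; rewrite sqr_sqrtr// addr_ge0 ?sqr_ge0. Qed.

Lemma abs_Re_le_normc (R : rcfType) (z : R[i]) :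
  `|complex.Re z| <= Normc.normc z.
Proof.
rewrite -(ler_pXn2r (n := 2)) ?nnegrE ?normc_ge0//.
by rewrite real_normK ?num_real// sqr_normcE lerDl sqr_ge0.
Qed.

Lemma abs_Im_le_normc (R : rcfType) (z : R[i]) :
  `|complex.Im z| <= Normc.normc z.
Proof.
rewrite -(ler_pXn2r (n := 2)) ?nnegrE ?normc_ge0//.
by rewrite real_normK ?num_real// sqr_normcE lerDr sqr_ge0.
Qed.

Lemma normc_le_abs (R : realType) (z : R[i]) :
  Normc.normc z <= `|complex.Re z| + `|complex.Im z|.
Proof.
case: z => a b /=; rewrite -[leRHS]ger0_norm ?addr_ge0// -sqrtr_sqr.
rewrite ler_wsqrtr// sqrrD !real_normK ?num_real// -addrA [_ *+ _ + _]addrC addrA.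
by rewrite lerDl mulrn_wge0// mulr_ge0.
Qed.

(** * Borel sets, measurable maps and invariance *)

Lemma borel_open (X : ptopologicalType) (U : set X) :
  open U -> measurable (U : set (borelType X)).
Proof. by move=> oU; exact: sub_sigma_algebra. Qed.

Lemma borel_closed (X : ptopologicalType) (F : set X) :
  closed F -> measurable (F : set (borelType X)).
Proof.
move=> cF; rewrite -[F]setCK; apply: measurableC; apply: borel_open.
exact: closed_openC.
Qed.

Lemma metric_compact_closed (R : realType) (X : pmetricType R) (K : set X) :
  compact K -> closed K.
Proof. by move=> cK; apply: compact_closed => //; exact: metric_hausdorff. Qed.

Lemma borel_compact (R : realType) (X : pmetricType R) (K : set X) :
  compact K -> measurable (K : set (borelType X)).
Proof. by move/metric_compact_closed/borel_closed. Qed.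

Lemma continuous_borel (X : ptopologicalType) (T : X -> X) :
  continuous T -> measurable_fun [set: borelType X] (T : borelType X -> borelType X).
Proof.
move=> /continuousP cT.
apply: (@measurability _ _ (borelType X) (borelType X) setT T (@open X) erefl).
move=> _ [U oU <-].
by rewrite setTI; apply: borel_open; exact: cT.
Qed.

Lemma measurable_iter d (Y : measurableType d) (S : Y -> Y) n :
  measurable_fun [set: Y] S -> measurable_fun [set: Y] (iter n S).
Proof.
move=> mS; elim: n => [|n IH]; first exact: measurable_id.
exact: measurableT_comp mS IH.
Qed.

Lemma ge0_integral_invariant d (Y : measurableType d) (R : realType)
    (mu : {measure set Y -> \bar R}) (S : Y -> Y) (g : Y -> \bar R) :
  measurable_fun [set: Y] S ->
  (forall B, measurable B -> mu (S @^-1` B) = mu B) ->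
  measurable_fun [set: Y] g -> (forall x, 0 <= g x)%E ->
  (\int[mu]_x g (S x) = \int[mu]_x g x)%E.
Proof.
move=> mS invS mg g0.
transitivity (\int[pushforward mu S]_y g y)%E.
  by rewrite ge0_integral_pushforward// ?preimage_setT// => y _; exact: g0.
by apply: eq_measure_integral => B mB _; exact: invS.
Qed.

Lemma ge0_integral_iter d (Y : measurableType d) (R : realType)
    (mu : {measure set Y -> \bar R}) (S : Y -> Y) (g : Y -> \bar R) n :
  measurable_fun [set: Y] S ->
  (forall B, measurable B -> mu (S @^-1` B) = mu B) ->
  measurable_fun [set: Y] g -> (forall x, 0 <= g x)%E ->
  (\int[mu]_x g (iter n S x) = \int[mu]_x g x)%E.
Proof.
move=> mS invS mg g0; elim: n => // n IH.
rewrite -IH -(@ge0_integral_invariant _ _ _ mu S (fun x => g (iter n S x)))//.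
  by apply: eq_integral => x _; rewrite iterSr.
exact: measurableT_comp mg (measurable_iter n mS).
Qed.

Lemma measurable_sqr_normc d (Y : measurableType d) (R : realType)
    (h : Y -> R[i]) :
  measurable_fun [set: Y] (fun x => complex.Re (h x)) ->
  measurable_fun [set: Y] (fun x => complex.Im (h x)) ->
  measurable_fun [set: Y] (fun x => Normc.normc (h x) ^+ 2).
Proof.
move=> mRe mIm; under eq_fun do rewrite sqr_normcE.
by apply: measurable_funD; exact: measurable_funX.
Qed.

Lemma measurable_superlevel d (Y : measurableType d) (R : realType)
    (u : Y -> R) (r : R) :
  measurable_fun [set: Y] u -> measurable [set x | r <= u x].
Proof.
move=> u_meas.
have -> : [set x | r <= u x] = setT `&` u @^-1` `[r, +oo[%classic.
  by rewrite setTI; apply/seteqP; split=> x /=; rewrite in_itv/= andbT.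
exact: u_meas.
Qed.

Lemma measurable_floor_preimage d (Y : measurableType d) (R : realType)
    (u : Y -> R) (k : R) (z : int) :
  measurable_fun [set: Y] u ->
  measurable ((fun x => Num.floor (k * u x)) @^-1` [set z]).
Proof.
move=> u_meas.
have -> : (fun x => Num.floor (k * u x)) @^-1` [set z] =
    setT `&` (fun x => k * u x) @^-1` `[z%:~R, (z + 1)%:~R[%classic.
  rewrite setTI; apply/seteqP; split=> x /=; rewrite in_itv/=.
    by move=> <-; rewrite floor_itv.
  by move=> /floor_def.
have mku : measurable_fun [set: Y] (fun x => k * u x).
  by apply: measurable_funM => //; exact: measurable_cst.
exact: mku.
Qed.

(** * Rigidity as recurrence *)

(** The square of the L^2 norm; an integral is easier to add up and to transport
    by an invariant map than its square root. *)
Definition energy (R : realType) (X : pmetricType R)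
    (mu : {measure set (borelType X) -> \bar R}) (h : X -> R[i]) : \bar R :=
  (\int[mu]_x ((Normc.normc (h x)) ^+ 2)%:E)%E.

Lemma cLnorm2E (R : realType) (X : pmetricType R)
    (mu : {measure set (borelType X) -> \bar R}) (h : X -> R[i]) :
  (cLnorm2 mu h `^ 2 = energy mu h)%E.
Proof.
rewrite /cLnorm2 powR_Lnorm; last by rewrite pnatr_eq0.
apply: eq_integral => x _ /=.
by rewrite powR_mulrn ?real_normK ?num_real.
Qed.

Lemma cLnorm2_lt (R : realType) (X : pmetricType R)
    (mu : {measure set (borelType X) -> \bar R}) (h : X -> R[i]) (e : R) :
  0 < e -> (cLnorm2 mu h < e%:E)%E = (energy mu h < (e ^+ 2)%:E)%E.
Proof.
move=> e0; rewrite -cLnorm2E.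
have : (0 <= cLnorm2 mu h)%E by exact: Lnorm_ge0.
case: (cLnorm2 mu h) => [r| |]//=; last first.
  by rewrite pnatr_eq0 !ltNge !leey.
rewrite lee_fin => r0.
by rewrite !lte_fin powR_mulrn// ltr_pXn2r// nnegrE ltW.
Qed.

Definition recurrent (R : realType) (X : pmetricType R) (T : X -> X)
    (mu : {measure set (borelType X) -> \bar R}) (f : X -> R[i]) : Prop :=
  forall e : R, 0 < e -> forall N : nat, exists2 t, (N < t)%N &
    (energy mu (fun x => (f (iter t T x) - f x)%R) < e%:E)%E.

(** Recurrence quantifies separately over the precision and the time, so it
    yields subsequences with any prescribed rate of convergence. *)
Lemma rigidP (R : realType) (X : pmetricType R) (T : X -> X)
    (mu : {measure set (borelType X) -> \bar R}) (f : X -> R[i]) :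
  rigid T mu f <-> recurrent T mu f.
Proof.
split=> [[t st /ge0_cvge0P t0] e e0 N|rf].
  have [//||M _ tlt] := t0 _ (Num.sqrt e); first by move=> k; exact: Lnorm_ge0.
    by rewrite sqrtr_gt0.
  exists (t (maxn M N.+1)).
    by apply: leq_trans (subsequence_ge _ st); rewrite leq_maxr.
  have := tlt (maxn M N.+1) (leq_maxl _ _).
  by rewrite cLnorm2_lt ?sqrtr_gt0// sqr_sqrtr// ltW.
have [|s ss slt] := @exists_subsequence (fun k t =>
    energy mu (fun x => (f (iter t T x) - f x)%R) < (k.+1%:R^-1 ^+ 2)%:E)%E.
  by move=> k N; apply: rf; rewrite exprn_gt0// invr_gt0.
exists s => //; apply/ge0_cvge0P => [k|e e0]; first exact: Lnorm_ge0.
near=> k; apply: (@lt_trans _ _ k.+1%:R^-1%:E).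
  by rewrite cLnorm2_lt// invr_gt0.
rewrite lte_fin; near: k; exact: near_infty_natSinv_lt (PosNum e0).
Unshelve. all: by end_near. Qed.

(** * Lusin's theorem on a compact metric space *)

(** A Lebesgue number: near a point [x] where [c] is constant on a ball of radius
    [d], every pair of points of [K] with one of them in the ball of radius [d / 2]
    about [x] and at distance less than [d / 2] stays in the larger ball. *)
Lemma compact_locally_constant (R : realType) (X : metricType R) (I : Type)
    (K : set X) (c : X -> I) :
  compact K ->
  (forall x, K x -> exists2 d : R, 0 < d &
    forall y, K y -> mdist x y < d -> c x = c y) ->
  exists2 d : R, 0 < d & forall x y, K x -> K y -> mdist x y < d -> c x = c y.
Proof.
move=> /compact_near_coveringP cK lc.
pose P (d : R) x := K x -> forall y, K y -> mdist x y < d -> c x = c y.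
have [x Kx|d /= d0 dP] := cK R 0^'+ P _; last first.
  exists (d / 2); first by rewrite divr_gt0.
  move=> x y Kx; apply: (dP (d / 2)) => //=; last by rewrite divr_gt0.
  rewrite sub0r normrN gtr0_norm ?divr_gt0//; lra.
have [d d0 dc] := lc x Kx.
exists (ball x (d / 2), [set r : R | 0 < r < d / 2]) => /=.
  split; first by apply: nbhsx_ballx; rewrite divr_gt0.
  near=> r; apply/andP; split; near: r; first exact: nbhs_right_gt.
  by apply: nbhs_right_lt; rewrite divr_gt0.
move=> [x' r] /= [xx' /andP[r0 rd]] Kx' y Ky x'y.
rewrite ballEmdist /= in xx'.
rewrite -(dc x')//; last by lra.
apply: dc => //; have := metric_triangle x x' y; lra.
Unshelve. all: by end_near. Qed.

Section lusin.
Context (R : realType) (X : pmetricType R) (mu : probability (borelType X) R).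
Hypothesis cX : compact [set: X].
Hypothesis regmu : regular_measure mu.

Lemma regular_bracket (B : set (borelType X)) (e : R) :
  measurable B -> 0 < e ->
  exists KU : set X * set X, [/\ compact KU.1, open KU.2,
    KU.1 `<=` B, B `<=` KU.2 & (mu (KU.2 `\` KU.1) <= e%:E)%E].
Proof.
move=> mB e0; have [supB infB] := regmu mB.
have e20 : 0 < e / 2 by rewrite divr_gt0.
have Bfin : mu B \is a fin_num by exact: fin_num_measure.
have [|_ [K [cK KB] <-] ltK] := @ub_ereal_sup_adherent R
  [set mu K | K in [set K : set X | compact K /\ K `<=` B]] _ e20.
  by rewrite -supB.
have [|_ [U [oU BU] <-] ltU] := @lb_ereal_inf_adherent R
  [set mu U | U in [set U : set X | open U /\ B `<=` U]] _ e20.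
  by rewrite -infB.
exists (K, U); split=> //=.
have mK := borel_compact cK; have mU := borel_open oU.
have {}ltK : (mu B - (e / 2)%:E < mu K)%E by rewrite [mu B]supB.
have {}ltU : (mu U < mu B + (e / 2)%:E)%E by rewrite [mu B]infB.
have -> : (mu (U `\` K) = mu U - mu K)%E.
  rewrite measureD//; last by rewrite ltey_eq fin_num_measure.
  by rewrite setIidr//; exact: subset_trans KB BU.
have Kfin : mu K \is a fin_num by exact: fin_num_measure.
have Ufin : mu U \is a fin_num by exact: fin_num_measure.
move: ltK ltU; rewrite -(fineK Bfin) -(fineK Kfin) -(fineK Ufin).
by rewrite -!EFinB -EFinD !lte_fin lee_fin; lra.
Qed.

(** Countably many measurable sets become relatively open in a large compact
    set. Bracket each [B i] between a compact and an open set whose difference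
    has small measure, and delete all the differences: in what remains, [B i]
    coincides with its open hull. *)
Lemma lusin_sets (I : countType) (B : I -> set (borelType X)) (e : R) :
  (forall i, measurable (B i)) -> 0 < e ->
  exists F : set X, [/\ compact F, (mu (~` F) <= e%:E)%E &
    forall i, exists2 U : set X, open U & F `&` U = F `&` B i].
Proof.
move=> mB e0.
(* The sets are renumbered by nat, to share out [e] as a geometric series. *)
pose B' n := oapp B set0 (choice.unpickle n).
have mB' n : measurable (B' n).
  by rewrite /B'; case: choice.unpickle => [i|] //=; exact: mB.
have en n : 0 < e / (2 ^ n.+1)%:R by rewrite divr_gt0// ltr0n expn_gt0.
have /choice[KU KUP] n := regular_bracket (mB' n) (en n).
have cK n : closed (KU n).1 by have [/metric_compact_closed] := KUP n.
have oU n : open (KU n).2 by have [] := KUP n.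
pose G := \bigcup_n ((KU n).2 `\` (KU n).1).
have oG : open G.
  by apply: bigcup_open => n _; apply: openI => //; exact: closed_openC.
exists (~` G); split.
- by apply: subclosed_compact cX _ => //; exact: open_closedC.
- rewrite setCK; apply: (le_trans _ (epsilon_trick0 xpredT (ltW e0))).
  apply: (@le_trans _ _ (\sum_(0 <= n <oo) mu ((KU n).2 `\` (KU n).1))%E).
    apply: measure_sigma_subadditive => // [n|]; last exact: borel_open.
    by apply: measurableD; [exact: borel_open|exact: borel_closed].
  by apply: lee_nneseries => // n _; have [] := KUP n.
- move=> i; exists (KU (choice.pickle i)).2 => //.
  have [_ _ KB BU _] := KUP (choice.pickle i); rewrite /B' choice.pickleK/= in KB BU.
  apply/seteqP; split=> x [Gx xU]; split=> //; last exact: BU.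
  apply: KB; apply: contrapT => xK; apply: Gx; by exists (choice.pickle i).
Qed.

(** For functions with values in a countable discrete set, continuity on a compact
    set means that close points have the same value; a single compact set serves
    a countable family of functions. *)
Lemma lusin_discrete (J I : countType) (c : J -> X -> I) (e : R) :
  (forall j i, measurable (c j @^-1` [set i] : set (borelType X))) -> 0 < e ->
  exists F : set X, [/\ compact F, (mu (~` F) <= e%:E)%E &
    forall j, exists2 delta : R, 0 < delta &
      forall x y, F x -> F y -> mdist x y < delta -> c j x = c j y].
Proof.
move=> mc e0.
have [F [cF muF FB]] := @lusin_sets _
  (fun p : J * I => c p.1 @^-1` [set p.2]) e (fun p => mc p.1 p.2) e0.
exists F; split=> // j.
apply: compact_locally_constant cF _ => x Fx.
have [U oU FUB] := FB (j, c j x).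
have [_ Ux] : (F `&` U) x by rewrite FUB.
have := open_nbhs_nbhs (conj oU Ux); rewrite -nbhs_ballE => -[d d0 dU].
exists d => // y Fy xy.
suff [_ /= ->] : (F `&` (c j @^-1` [set c j x])) y by [].
by rewrite -FUB; split=> //; apply: dU; rewrite ballEmdist.
Qed.

(** Rounding the two parts of [h n] to the grid of mesh [1 / (k + 1)] gives
    countably many functions with countably many values, and points with the
    same rounding have values at distance less than [2 / (k + 1)]. *)
Lemma lusin (h : nat -> X -> R[i]) (tau : R) :
  (forall n, measurable_fun [set: borelType X] (fun x => complex.Re (h n x))) ->
  (forall n, measurable_fun [set: borelType X] (fun x => complex.Im (h n x))) ->
  0 < tau ->
  exists F : set X, [/\ compact F, (mu (~` F) <= tau%:E)%E &
    forall n (e : R), 0 < e -> exists2 delta : R, 0 < delta &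
      forall x y, F x -> F y -> mdist x y < delta ->
        Normc.normc (h n x - h n y) < e].
Proof.
move=> mRe mIm tau0.
pose c (nk : nat * nat) x := (Num.floor (nk.2.+1%:R * complex.Re (h nk.1 x)),
                              Num.floor (nk.2.+1%:R * complex.Im (h nk.1 x))).
have [|F [cF muF Fc]] := @lusin_discrete _ _ c tau _ tau0.
  move=> [n k] [z w].
  rewrite (_ : _ @^-1` _ =
    ((fun x => Num.floor (k.+1%:R * complex.Re (h n x))) @^-1` [set z]) `&`
    ((fun x => Num.floor (k.+1%:R * complex.Im (h n x))) @^-1` [set w])).
    by apply: measurableI; exact: measurable_floor_preimage.
  by apply/seteqP; split=> x; rewrite /c /=; [case=> <- <-|case=> -> ->].
exists F; split=> // n e e0.
pose k := Num.truncn (2 / e).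
have [d d0 Fd] := Fc (n, k).
exists d => // x y Fx Fy /(Fd _ _ Fx Fy)[/floor_eq_dist rxy /floor_eq_dist ixy].
have k2 : 2 < k.+1%:R * e by rewrite -ltr_pdivrMr// truncnS_gt.
apply: le_lt_trans (normc_le_abs _) _.
rewrite -(ltr_pM2l (ltr0Sn R k)) mulrDr.
move: rxy ixy; rewrite -!mulrBr !normrM !normr_nat.
case: (h n x) (h n y) => [a b] [a' b'] /=; lra.
Qed.
End lusin.

(** * From recurrence to equicontinuity *)

Section rigid_to_equicontinuous.
Context (R : realType) (X : pmetricType R) (mu : probability (borelType X) R).
Context (T : X -> X) (f : X -> R[i]).
Hypothesis cX : compact [set: X].
Hypothesis regmu : regular_measure mu.
Hypothesis mT : measurable_fun [set: borelType X] (T : borelType X -> borelType X).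
Hypothesis mRe : measurable_fun [set: borelType X] (fun x => complex.Re (f x)).
Hypothesis mIm : measurable_fun [set: borelType X] (fun x => complex.Im (f x)).

Lemma chebyshev_energy (h : X -> R[i]) (r e : R) :
  measurable_fun [set: borelType X] (fun x => Normc.normc (h x) ^+ 2) ->
  0 < r -> (energy mu h <= (r * e)%:E)%E ->
  (mu [set x | (r <= Normc.normc (h x) ^+ 2)%R] <= e%:E)%E.
Proof.
move=> mh r0 he; set E := [set x | _].
have mE : measurable (E : set (borelType X)) by exact: measurable_superlevel.
have mhE : measurable_fun [set: borelType X] (fun x => (Normc.normc (h x) ^+ 2)%:E).
  exact/measurable_EFinP.
rewrite -(@lee_pmul2l _ r%:E)// -EFinM; apply: le_trans he.
rewrite -integral_cst//; apply: (@le_trans _ _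
    (\int[mu]_(x in E) (Normc.normc (h x) ^+ 2)%:E)%E).
  apply: ge0_le_integral => //.
  - by move=> x _; rewrite lee_fin ltW.
  - exact: measurable_funTS.
apply: ge0_subset_integral => //.
by move=> x _; rewrite lee_fin sqr_ge0.
Qed.

(** Borel-Cantelli with explicit rates. By Chebyshev the set where
    [|g n| >= 2^-n] has measure at most [2^-(n+1)]; their union over [n >= N] has
    measure at most [2^-N], and outside it [|g n| < 2^-n] for all [n >= N]. *)
Lemma uniform_off_small_set (g : nat -> X -> R[i]) (tau : R) :
  (forall n, measurable_fun [set: borelType X]
    (fun x => Normc.normc (g n x) ^+ 2)) ->
  (forall n, energy mu (g n) <= (4^-1 ^+ n * (2^-1 ^+ n / 2))%:E)%E ->
  0 < tau ->
  exists E : set X, [/\ measurable (E : set (borelType X)), (mu E <= tau%:E)%E &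
    forall e : R, 0 < e -> exists M, forall n, (M <= n)%N ->
      forall x, ~ E x -> Normc.normc (g n x) < e].
Proof.
move=> mg g_small tau0.
have small e : 0 < e -> exists N, 2^-1 ^+ N < e :> R.
  move=> e0; have : 2^-1 ^+ n @[n --> \oo] --> (0 : R).
    by apply: cvg_expr; rewrite ger0_norm ?invr_ge0// invf_lt1// ltr1n.
  move=> /cvgr0_norm_lt /(_ e e0)[N _ /(_ N (leqnn N))] /=.
  by rewrite ger0_norm ?exprn_ge0 ?invr_ge0// => lt_e; exists N.
have [N Ntau] := small _ tau0.
pose E n := [set x | 4^-1 ^+ n <= Normc.normc (g n x) ^+ 2].
have mE n : measurable (E n : set (borelType X)).
  exact: measurable_superlevel.
exists (\bigcup_n E (n + N)%N); split.
- exact: bigcup_measurable.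
- apply: (@le_trans _ _ (2^-1 ^+ N)%:E); last by rewrite lee_fin ltW.
  have N0 : 0 <= 2^-1 ^+ N :> R by rewrite exprn_ge0 ?invr_ge0.
  apply: (le_trans _ (epsilon_trick0 xpredT N0)).
  apply: (@le_trans _ _ (\sum_(0 <= n <oo) mu (E (n + N)%N))%E).
    by apply: measure_sigma_subadditive => //; exact: bigcup_measurable.
  apply: lee_nneseries => // n _.
  apply: (@chebyshev_energy _ (4^-1 ^+ (n + N))) => //.
  rewrite (_ : 2^-1 ^+ N / _ = 2^-1 ^+ (n + N) / 2); first exact: g_small.
  by rewrite natrX exprS exprD invfM -exprVn; ring.
- move=> e /small[M Me]; exists (maxn M N) => n.
  rewrite geq_max => /andP[Mn Nn] x xE.
  apply: le_lt_trans (_ : 2^-1 ^+ n < _); last first.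
    apply: le_lt_trans Me; apply: ler_wiXn2l => //; rewrite ?invr_ge0//.
    by rewrite invf_le1// ler1n.
  rewrite leNgt; apply/negP => lt_n; apply: xE; exists (n - N)%N => //=.
  rewrite /E /= subnK// (_ : 4^-1 = 2^-1 ^+ 2 :> R); last by rewrite exprVn -natrX.
  by rewrite exprAC lerXn2r ?nnegrE ?exprn_ge0 ?invr_ge0 ?normc_ge0// ltW.
Qed.

(** On the compact set found below, finitely many functions [f o T^(a n)] are
    handled by their own uniform continuity, and the others are uniformly
    close to the uniformly continuous function [f]. *)
Lemma recurrent_equicontinuous :
  recurrent T mu f ->
  exists2 a, subsequence a & measure_equicontinuous T mu f a.
Proof.
move=> rec.
have [|a sa a_small] := @exists_subsequence (fun n t =>
    energy mu (fun x => (f (iter t T x) - f x)%R)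
      < (4^-1 ^+ n * (2^-1 ^+ n / 2))%:E)%E.
  by move=> n N; apply: rec; rewrite !(mulr_gt0, exprn_gt0) ?invr_gt0.
exists a => // tau tau0.
(* [f] itself is put in front of its translates. *)
pose h n := if n is n'.+1 then fun x => f (iter (a n') T x) else f.
have mRe' n : measurable_fun [set: borelType X] (fun x => complex.Re (h n x)).
  by case: n => [|n] //=; exact: measurableT_comp mRe (measurable_iter _ mT).
have mIm' n : measurable_fun [set: borelType X] (fun x => complex.Im (h n x)).
  by case: n => [|n] //=; exact: measurableT_comp mIm (measurable_iter _ mT).
have tau4 : 0 < tau / 4 by rewrite divr_gt0.
have [F [cF muF Fh]] := lusin cX regmu mRe' mIm' tau4.
have [||E [mE muE Eg]] := @uniform_off_small_set
    (fun n x => f (iter (a n) T x) - f x) (tau / 4) _ _ tau4.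
- move=> n; apply: measurable_sqr_normc.
    under eq_fun do rewrite raddfB; exact: measurable_funB (mRe' n.+1) mRe.
  under eq_fun do rewrite raddfB; exact: measurable_funB (mIm' n.+1) mIm.
- by move=> n; exact/ltW/a_small.
have [K [U [/= cK oU KE EU muK]]] : exists K U : set X,
  [/\ compact K, open U, K `<=` ~` E, ~` E `<=` U &
      (mu (U `\` K) <= (tau / 4)%:E)%E].
  have [[K U] KU] := regular_bracket regmu (measurableC mE) tau4.
  by exists K, U.
exists (F `&` K); split.
- by apply: compact_closedI => //; exact: metric_compact_closed.
- move=> e e0; have e3 : 0 < e / 3 by rewrite divr_gt0.
  have [M Mg] := Eg _ e3.
  have [d0 d0_gt0 fd0] := Fh 0%N _ e3.
  have [||d d_gt0 hd] := @min_modulus R (fun n d => forall x y, F x -> F y ->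
     mdist x y < d -> Normc.normc (h n.+1 x - h n.+1 y) < e) M.
  + by move=> n; exact: Fh.
  + move=> n d d' d'd hd x y Fx Fy xy; apply: hd => //; exact: lt_le_trans d'd.
  exists (Num.min d0 d); first by rewrite lt_min d0_gt0.
  move=> x y [Fx Kx] [Fy Ky]; rewrite lt_min => /andP[xyd0 xyd] n.
  have [nM|Mn] := ltnP n M; first exact: hd.
  have := fd0 x y Fx Fy xyd0.
  have := Mg n Mn x (KE _ Kx); have := Mg n Mn y (KE _ Ky).
  rewrite (normc_dist (f (iter (a n) T y))) /=.
  have := normc_dist_trans (f x) (f (iter (a n) T x)) (f (iter (a n) T y)).
  have := normc_dist_trans (f y) (f x) (f (iter (a n) T y)).
  lra.
- have [mF mK mU] : [/\ measurable (F : set (borelType X)),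
      measurable (K : set (borelType X)) & measurable (U : set (borelType X))].
    by split; [exact: borel_compact|exact: borel_compact|exact: borel_open].
  have mFK := measurableI _ _ mF mK.
  have : (mu (~` (F `&` K)) <= (tau / 4)%:E + (tau / 4)%:E + (tau / 4)%:E)%E.
    apply: (@le_trans _ _ (mu (~` F `|` E `|` U `\` K))).
      apply: le_measure; rewrite ?inE.
      - exact: measurableC.
      - apply: measurableU; last exact: measurableD.
        by apply: measurableU => //; exact: measurableC.
      - move=> x /= FKx; have [Ex|/EU Ux] := pselect (E x); first by left; right.
        have [Fx|Fx] := pselect (F x); last by left; left.
        by right; split=> // Kx; apply: FKx.
    apply: (le_trans (measureU2 _ _ _)).
    - by apply: measurableU => //; exact: measurableC.
    - exact: measurableD.
    apply: leeD => //; apply: (le_trans (measureU2 _ _ _)) => //.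
      exact: measurableC.
    exact: leeD.
  rewrite probability_setC// -(fineK (fin_num_measure mu _ mFK)).
  rewrite -EFinB -!EFinD lee_fin lte_fin; lra.
Qed.

End rigid_to_equicontinuous.

(** * Truncation *)

Definition clamp (R : realDomainType) (M t : R) : R := Num.max (- M) (Num.min M t).

Section clamp.
Context (R : realFieldType) (M : R).
Hypothesis M0 : 0 <= M.

Lemma clampE t :
  clamp M t = if M <= t then M else if t <= - M then - M else t.
Proof.
rewrite /clamp; case: (leP M t) => Mt.
  by rewrite max_r//; move: M0; lra.
by case: (leP (- M) t) => tM; case: (leP t (- M)) => //; lra.
Qed.

Lemma clamp_bound t : - M <= clamp M t <= M.
Proof.
rewrite clampE; case: (leP M t) => ?; case: (leP t (- M)) => ?.
all: apply/andP; split; move: M0; lra.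
Qed.

Lemma clamp_id t : `|t| <= M -> clamp M t = t.
Proof.
by rewrite ler_norml => /andP[t1 t2]; rewrite /clamp min_r// max_r.
Qed.

Lemma clamp_lipschitz s t : `|clamp M s - clamp M t| <= `|s - t|.
Proof.
wlog st : s t / s <= t => [wl|].
  have [/wl//|/ltW/wl] := leP s t.
  by rewrite distrC [X in _ <= X]distrC.
rewrite ![ `|_ - t|]distrC ![ `|_ - clamp M t|]distrC.
have clamp_le : 0 <= clamp M t - clamp M s <= t - s.
{ rewrite !clampE; case: (leP M s) => ?; case: (leP s (- M)) => ?;
    case: (leP M t) => ?; case: (leP t (- M)) => ?.
  all: apply/andP; split; move: M0; lra. }
rewrite !ger0_norm ?subr_ge0//; case/andP: clamp_le; lra.
Qed.

Lemma clamp_rem t : (t - clamp M t) ^+ 2 <= t ^+ 2.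
Proof.
rewrite clampE; case: (leP M t) => ?; case: (leP t (- M)) => ?.
all: move: M0; nra.
Qed.

End clamp.

Lemma measurable_clamp d (Y : measurableType d) (R : realType) (M : R)
    (u : Y -> R) :
  measurable_fun [set: Y] u -> measurable_fun [set: Y] (fun x => clamp M (u x)).
Proof.
move=> u_meas; apply: measurable_maxr; first exact: measurable_cst.
by apply: measurable_minr => //; exact: measurable_cst.
Qed.

(** Dominated convergence: at each point the truncation error vanishes as soon as
    [M] exceeds [|u|], and its square is at most [u ^ 2]. *)
Lemma truncation_L2 d (Y : measurableType d) (R : realType)
    (mu : {measure set Y -> \bar R}) (u : Y -> R) (e : R) :
  measurable_fun [set: Y] u -> (\int[mu]_x (u x ^+ 2)%:E < +oo)%E -> 0 < e ->
  exists2 M, 0 <= M & (\int[mu]_x ((u x - clamp M (u x)) ^+ 2)%:E < e%:E)%E.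
Proof.
move=> u_meas uL2 e0.
pose r (n : nat) x := ((u x - clamp n%:R (u x)) ^+ 2)%:E.
have mr n : measurable_fun [set: Y] (r n).
  apply/measurable_EFinP/measurable_funX/measurable_funB => //.
  exact: measurable_clamp.
have r0 n x : (0 <= r n x)%E by rewrite lee_fin sqr_ge0.
have [] := @dominated_convergence _ _ _ mu setT measurableT r (cst 0%E)
  (fun x => (u x ^+ 2)%:E) mr.
- exact: measurable_cst.
- apply: aeW => x _; apply: cvg_near_cst.
  exists (Num.truncn `|u x|).+1 => // n /= ltn.
  rewrite /r clamp_id ?subrr ?expr0n//.
  by rewrite ltW// (lt_le_trans (truncnS_gt _))// ler_nat.
- apply/integrableP; split; first exact/measurable_EFinP/measurable_funX.
  by under eq_integral do rewrite gee0_abs ?lee_fin ?sqr_ge0//.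
- apply: aeW => x n _; rewrite gee0_abs// lee_fin.
  by apply: clamp_rem.
move=> _ _; rewrite integral0 => /ge0_cvge0P-/(_ _ _ e0).
move=> [n|N _ /(_ N (leqnn N)) lt_e].
  exact: integral_ge0.
by exists N%:R.
Qed.

(** * From equicontinuity to recurrence *)

Section equicontinuous_to_rigid.
Context (R : realType) (X : pmetricType R) (mu : probability (borelType X) R).
Context (T : X -> X).
Hypothesis mT : measurable_fun [set: borelType X] (T : borelType X -> borelType X).
Hypothesis invT : invariant_measure T mu.

Lemma finite_net (K : set X) (d : R) : compact K -> 0 < d ->
  exists D : {fset X}, {in D, forall y, K y} /\
    forall x, K x -> exists2 y, y \in D & mdist y x < d.
Proof.
rewrite compact_cover => cK d0.
have [||D DK KD] := cK X K (fun y => (ball y d)°).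
- by move=> y _; exact: open_interior.
- by move=> x Kx; exists x => //; exact: nbhsx_ballx.
exists D; split=> [y /DK/set_mem//|x /KD[y /= yD /interior_subset]].
by rewrite ballEmdist => yx; exists y.
Qed.

(** Total boundedness of the sequence [w] in L^2, phrased with colours: this form
    does not name centres of balls, passes to pairs of sequences by taking pairs
    of colours, and is ready for the pigeonhole principle. *)
Definition L2_finite_colouring (w : nat -> X -> R) : Prop :=
  forall e : R, 0 < e -> exists (C : finType) (c : nat -> C),
    forall n m, c n = c m -> (\int[mu]_x ((w n x - w m x) ^+ 2)%:E < e%:E)%E.

(** Rounding: the bounded values are cut into steps of length [eta], and the colour
    of [n] records the step of each of its finitely many values. *)
Lemma bounded_colouring (J : finType) (w : nat -> J -> R) (M eta : R) :
  0 < eta -> (forall n j, - M <= w n j <= M) ->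
  exists (C : finType) (c : nat -> C),
    forall n m, c n = c m -> forall j, `|w n j - w m j| < eta.
Proof.
move=> eta0 wM; pose L := Num.truncn ((M + M) / eta).
pose k n j := Num.truncn ((w n j + M) / eta).
have kL n j : (k n j < L.+1)%N.
  rewrite ltnS le_truncn// ler_pM2r ?invr_gt0//.
  by have /andP[_] := wM n j; lra.
exists {ffun J -> 'I_L.+1}, (fun n => [ffun j => Ordinal (kL n j)]).
move=> n m /ffunP knm j; move: (knm j); rewrite !ffunE => -[].
have pos i : 0 <= (w i j + M) / eta.
  by rewrite divr_ge0// ?(ltW eta0)//; have /andP[+ _] := wM i j; lra.
have /andP[n1 n2] := truncn_itv (pos n); have /andP[m1 m2] := truncn_itv (pos m).
rewrite /k => E; rewrite E in n1 n2.
rewrite -(ltr_pM2r (x := eta^-1)) ?invr_gt0// divff ?gt_eqF//.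
rewrite -[eta^-1]gtr0_norm ?invr_gt0// -normrM.
have -> : (w n j - w m j) / eta = (w n j + M) / eta - (w m j + M) / eta by ring.
rewrite ltr_norml; move: n1 n2 m1 m2; rewrite -natr1 => n1 n2 m1 m2.
apply/andP; split; lra.
Qed.

(** Write [u = clamp M u + r]. For indices [n], [m] of the same colour the clamped
    parts differ by less than [3 * eta] on the compact set [K], by comparison
    with a point of the net, and by at most [2 * M] elsewhere, while [r o T^(a n)]
    and [r o T^(a m)] have the same small L^2 norm as [r]. *)
Lemma equicontinuous_colouring (u : X -> R) (a : nat -> nat) :
  measurable_fun [set: borelType X] (u : borelType X -> R) ->
  (\int[mu]_x (u x ^+ 2)%:E < +oo)%E ->
  (forall tau : R, 0 < tau -> exists K : set X, [/\ compact K,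
    forall e : R, 0 < e -> exists2 d : R, 0 < d &
      forall x y, K x -> K y -> mdist x y < d ->
        forall n, `|u (iter (a n) T x) - u (iter (a n) T y)| < e &
    (mu K > (1 - tau)%:E)%E]) ->
  L2_finite_colouring (fun n x => u (iter (a n) T x)).
Proof.
move=> u_meas uL2 equi e e0.
(* The bound [B] below has integral at most
   [e / 4 + e / 4 + e / 8 + e / 8], which fixes the constants. *)
have e12 : 0 < e / 12 by rewrite divr_gt0.
have [M M0 rM] := truncation_L2 u_meas uL2 e12.
pose r x := u x - clamp M (u x).
pose eta := Num.min 1 (e / 216).
have eta0 : 0 < eta by rewrite /eta lt_min ltr01 divr_gt0.
have eta2 : 27 * eta ^+ 2 <= e / 8.
  have eta1 : eta <= 1 by rewrite /eta ge_min lexx.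
  have : eta <= e / 216 by rewrite /eta ge_min lexx orbT.
  by nra.
pose tau := e / (8 * (12 * M ^+ 2 + 1)).
have den0 : 0 < 8 * (12 * M ^+ 2 + 1).
  by rewrite mulr_gt0// ltr_wpDl// mulr_ge0// sqr_ge0.
have tau0 : 0 < tau by rewrite divr_gt0.
have tauM : 12 * M ^+ 2 * tau <= e / 8.
  have : tau * (8 * (12 * M ^+ 2 + 1)) = e by rewrite /tau divfK// gt_eqF.
  nra.
have [K [cK equiK muK]] := equi _ tau0.
have [d d0 Kd] := equiK _ eta0.
have [D [DK KD]] := finite_net cK d0.
pose w n x := clamp M (u (iter (a n) T x)).
have [C [c cw]] := @bounded_colouring D (fun n j => w n (val j)) M eta eta0
  (fun n j => clamp_bound M0 _).
exists C, c => n m cnm.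
have wK x : K x -> `|w n x - w m x| < 3 * eta.
  move=> Kx; have [y yD yx] := KD x Kx.
  have Ky := DK y yD.
  have close i : `|w i y - w i x| < eta.
    exact: le_lt_trans (clamp_lipschitz M0 _ _) (Kd y x Ky Kx yx i).
  have := cw n m cnm [` yD]%fset; rewrite /= => nm.
  have := close n; have := close m; move: nm; rewrite !ltr_norml.
  move=> /andP[? ?] /andP[? ?] /andP[? ?]; apply/andP; split; lra.
have mK : measurable (K : set (borelType X)) by exact: borel_compact.
pose B x := 3 * r (iter (a n) T x) ^+ 2 + 3 * r (iter (a m) T x) ^+ 2
  + (27 * eta ^+ 2 + 12 * M ^+ 2 * \1_(~` K) x).
have bound x : (u (iter (a n) T x) - u (iter (a m) T x)) ^+ 2 <= B x.
  have -> : u (iter (a n) T x) - u (iter (a m) T x) =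
    r (iter (a n) T x) - r (iter (a m) T x) + (w n x - w m x) by rewrite /r /w; ring.
  have : (w n x - w m x) ^+ 2 <= 9 * eta ^+ 2 + 4 * M ^+ 2 * \1_(~` K) x.
    rewrite indicE in_setC; have [/set_mem Kx|_] /= := boolP (x \in K).
      have := wK x Kx; rewrite mulr0 addr0 -(ltr_pXn2r (n := 2)) ?nnegrE//.
        by rewrite real_normK ?num_real// exprMn => /ltW; lra.
      by rewrite mulr_ge0// ltW.
    have : `|w n x - w m x| <= 2 * M.
      have /andP[? ?] : - M <= w n x <= M by exact: clamp_bound.
      have /andP[? ?] : - M <= w m x <= M by exact: clamp_bound.
      by rewrite ler_norml; apply/andP; split; lra.
    rewrite -(ler_pXn2r (n := 2)) ?nnegrE ?mulr_ge0// real_normK ?num_real//.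
    have := sqr_ge0 eta; rewrite exprMn; lra.
  rewrite /B; move: (r (iter (a n) T x)) (r (iter (a m) T x)) (w n x - w m x).
  move=> p q s sle.
  (* 3 (p^2 + q^2 + s^2) - (p - q + s)^2 is the sum of these three squares. *)
  have := sqr_ge0 (p + q); have := sqr_ge0 (p - s); have := sqr_ge0 (q + s).
  by nra.
have mcl : measurable_fun [set: borelType X] (fun x : borelType X => r x ^+ 2).
  by apply: measurable_funX; apply: measurable_funB => //; exact: measurable_clamp.
have mri i : measurable_fun [set: borelType X]
    (fun x : borelType X => (3 * r (iter (a i) T x) ^+ 2)%:E).
  apply/measurable_EFinP/measurable_funM; first exact: measurable_cst.
  exact: (measurableT_comp mcl (measurable_iter (a i) mT)).
have mI : measurable_fun [set: borelType X]
    (fun x : borelType X => (12 * M ^+ 2 * \1_(~` K) x)%:E).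
  apply/measurable_EFinP/measurable_funM; first exact: measurable_cst.
  by apply: measurable_indic; exact: measurableC.
have rint i : (\int[mu]_x (3 * r (iter (a i) T x) ^+ 2)%:E <= (e / 4)%:E)%E.
  rewrite (@ge0_integral_iter _ _ _ mu T (fun x => (3 * r x ^+ 2)%:E))//.
  - under eq_integral do rewrite EFinM.
    rewrite ge0_integralZl_EFin//; last exact/measurable_EFinP.
      rewrite (_ : e / 4 = 3 * (e / 12)); last by lra.
      by rewrite EFinM lee_pmul2l// ltW.
    by move=> x _; rewrite lee_fin sqr_ge0.
  - by apply/measurable_EFinP/measurable_funM => //; exact: measurable_cst.
  - by move=> x; rewrite lee_fin mulr_ge0// sqr_ge0.
have muKC : (mu (~` K) <= tau%:E)%E.
  rewrite probability_setC//; move: muK.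
  rewrite -(fineK (fin_num_measure mu _ mK)) -EFinB lte_fin lee_fin; lra.
have M20 : 0 <= 12 * M ^+ 2 by rewrite mulr_ge0// sqr_ge0.
have eta20 : 0 <= 27 * eta ^+ 2 by rewrite mulr_ge0// sqr_ge0.
have mc : measurable_fun [set: borelType X]
    (fun x : borelType X => (27 * eta ^+ 2)%:E + (12 * M ^+ 2 * \1_(~` K) x)%:E)%E.
  by apply: emeasurable_funD => //; exact: measurable_cst.
have r30 i x : (0 <= (3 * r (iter (a i) T x) ^+ 2)%:E)%E.
  by rewrite lee_fin mulr_ge0// sqr_ge0.
have ind0 x : (0 <= (12 * M ^+ 2 * \1_(~` K) x)%:E)%E.
  by rewrite lee_fin mulr_ge0// indicE.
have BE : (fun x => (B x)%:E) = (fun x =>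
    (3 * r (iter (a n) T x) ^+ 2)%:E + (3 * r (iter (a m) T x) ^+ 2)%:E +
    ((27 * eta ^+ 2)%:E + (12 * M ^+ 2 * \1_(~` K) x)%:E))%E.
  by apply/funext => x; rewrite /B !EFinD.
apply: (@le_lt_trans _ _ (\int[mu]_x (B x)%:E)%E).
  apply: ge0_le_integral => //.
  - by move=> x _; rewrite lee_fin sqr_ge0.
  - apply/measurable_EFinP/measurable_funX/measurable_funB;
      exact: (measurableT_comp u_meas (measurable_iter _ mT)).
  - by rewrite BE; apply: emeasurable_funD => //; exact: emeasurable_funD.
  - by move=> x _; rewrite lee_fin.
rewrite BE ge0_integralD//; last 3 first.
- by move=> x _; rewrite adde_ge0.
- exact: emeasurable_funD.
- by move=> x _; rewrite adde_ge0// lee_fin.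
rewrite ge0_integralD// ge0_integralD//.
rewrite integral_cst// [X in (_ * X + _)%E](probability_setT mu) mule1.
have -> : (\int[mu]_x (12 * M ^+ 2 * \1_(~` K) x)%:E =
    (12 * M ^+ 2)%:E * mu (~` K))%E.
  under eq_integral do rewrite EFinM.
  rewrite ge0_integralZl_EFin//; last first.
    by apply/measurable_EFinP/measurable_indic; exact: measurableC.
  by rewrite integral_indic// ?setIT//; exact: measurableC.
have muKC' : ((12 * M ^+ 2)%:E * mu (~` K) <= (e / 8)%:E)%E.
  apply: (@le_trans _ _ ((12 * M ^+ 2)%:E * tau%:E)%E).
    exact: lee_wpmul2l.
  by rewrite -EFinM lee_fin.
apply: (@le_lt_trans _ _ ((e / 4)%:E + (e / 4)%:E + ((e / 8)%:E + (e / 8)%:E))%E).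
  by apply: leeD; apply: leeD.
rewrite -!EFinD lte_fin; lra.
Qed.

(** Pairing the colours of the two parts colours the indices [i * (N + 1)];
    two of them share their colour, and since [a] is strictly increasing the
    corresponding times are more than [N] apart. *)
Lemma colouring_return (f : X -> R[i]) (a : nat -> nat) :
  measurable_fun [set: borelType X] (fun x => complex.Re (f x)) ->
  measurable_fun [set: borelType X] (fun x => complex.Im (f x)) ->
  subsequence a ->
  L2_finite_colouring (fun n x => complex.Re (f (iter (a n) T x))) ->
  L2_finite_colouring (fun n x => complex.Im (f (iter (a n) T x))) ->
  recurrent T mu f.
Proof.
move=> mRe mIm sa colRe colIm e e0 N.
have e2 : 0 < e / 2 by rewrite divr_gt0.
have [C1 [c1 c1P]] := colRe _ e2; have [C2 [c2 c2P]] := colIm _ e2.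
pose c (i : 'I_#|{: C1 * C2}|.+1) := (c1 (i * N.+1)%N, c2 (i * N.+1)%N).
have [i [j ij [c1ij c2ij]]] : exists i : 'I_#|{: C1 * C2}|.+1,
    exists2 j : 'I_#|{: C1 * C2}|.+1, (i < j)%N & c i = c j.
  have : ~~ injectiveb c.
    apply/negP => /injectiveP/leq_card; by rewrite card_ord ltnn.
  case/injectivePn => i [j ij cij].
  have [lt_ij|le_ji] := ltnP i j; first by exists i, j.
  by exists j, i => //; rewrite ltn_neqAle eq_sym ij.
pose p := a (i * N.+1)%N; pose q := a (j * N.+1)%N.
have a_gap k l : (a k + l <= a (k + l))%N.
  elim: l => [|l IH]; first by rewrite !addn0.
  by rewrite !addnS; apply: leq_ltn_trans IH (sa _ _ (ltnSn _)).
have pq : (p + N < q)%N.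
  rewrite -addnS; apply: (leq_trans (a_gap _ _)).
  by rewrite -mulSnr; apply: (ltnW_homo sa); rewrite leq_mul2r ij orbT.
exists (q - p)%N; first by rewrite ltn_subRL.
have mh n : measurable_fun [set: borelType X]
    (fun x : borelType X => complex.Re (f (iter n T x))).
  exact: (measurableT_comp mRe (measurable_iter n mT)).
have mh' n : measurable_fun [set: borelType X]
    (fun x : borelType X => complex.Im (f (iter n T x))).
  exact: (measurableT_comp mIm (measurable_iter n mT)).
rewrite /energy -(@ge0_integral_iter _ _ _ mu T (fun x =>
  (Normc.normc (f (iter (q - p) T x) - f x) ^+ 2)%:E) p)//; last first.
- by move=> x; rewrite lee_fin sqr_ge0.
- apply/measurable_EFinP/measurable_sqr_normc.
    under eq_fun do rewrite raddfB; exact: measurable_funB (mh _) mRe.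
  under eq_fun do rewrite raddfB; exact: measurable_funB (mh' _) mIm.
have le_pq := ltnW (leq_ltn_trans (leq_addr N p) pq).
under eq_integral => x _.
  rewrite -iterD subnK//.
  rewrite sqr_normcE !raddfB EFinD.
  over.
rewrite ge0_integralD//; last 4 first.
- by move=> x _; rewrite lee_fin sqr_ge0.
- apply/measurable_EFinP/measurable_funX/measurable_funB; exact: mh.
- by move=> x _; rewrite lee_fin sqr_ge0.
- apply/measurable_EFinP/measurable_funX/measurable_funB; exact: mh'.
rewrite (splitr e) EFinD.
by apply: lteD; [exact: c1P|exact: c2P].
Qed.
End equicontinuous_to_rigid.

(** * Rigidity is equicontinuity along a subsequence *)

Theorem corollary3p12 (R : realType) (X : pmetricType R) (T : X -> X)
    (mu : probability (borelType X) R) (f : X -> R[i]) :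
  compact [set: X] -> homeomorphism T ->
  regular_measure mu -> invariant_measure T mu ->
  in_L2 mu f ->
  rigid T mu f <->
  exists2 a : nat -> nat, subsequence a & measure_equicontinuous T mu f a.
Proof.
move=> cX [/continuous_borel mT _] regmu invT [mRe mIm fL2].
have mf2 : measurable_fun [set: borelType X] (fun x => (Normc.normc (f x) ^+ 2)%:E).
  exact/measurable_EFinP/measurable_sqr_normc.
have energy_fin : (energy mu f < +oo)%E by rewrite -cLnorm2E poweR_lty.
have colouring (part : R[i] -> R) (a : nat -> nat) :
    {morph part : z w / z - w} -> (forall z, `|part z| <= Normc.normc z) ->
    measurable_fun [set: borelType X] (fun x => part (f x)) ->
    measure_equicontinuous T mu f a ->
    L2_finite_colouring mu (fun n x => part (f (iter (a n) T x))).
  move=> partB part_le mpart equi.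
  apply: (equicontinuous_colouring mT invT mpart) => [|tau tau0].
    apply: le_lt_trans energy_fin; apply: ge0_le_integral => //.
    - by move=> x _; rewrite lee_fin sqr_ge0.
    - exact/measurable_EFinP/measurable_funX.
    - move=> x _; rewrite lee_fin -(real_normK (num_real (part _))).
      by rewrite ler_pXn2r ?nnegrE ?normc_ge0.
  have [K [cK equiK muK]] := equi _ tau0; exists K; split=> // e e0.
  have [d d0 Kd] := equiK _ e0; exists d => // x y Kx Ky xy n.
  by apply: le_lt_trans (Kd x y Kx Ky xy n); rewrite -partB.
split=> [/rigidP|[a sa equi]]; first exact: recurrent_equicontinuous.
apply/rigidP; apply: (colouring_return mT invT mRe mIm sa).
  by apply: colouring => //; [exact: raddfB|exact: abs_Re_le_normc].
by apply: colouring => //; [exact: raddfB|exact: abs_Im_le_normc].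
Qed.
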